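(* For all nonnegative multiplicity parameters $k:\Phi\to[0,\infty)$ and all $x\in V$, the map $s\mapsto F_{k,s}(x)$ is a log-convex and $W_0$-convex function on $V$.
   Context: $V\cong\mathbb R^n$ is a Euclidean space with inner product $\langle\cdot,\cdot\rangle$, extended complex-bilinearly to the complexification $V_{\mathbb C}$. $\Phi\subset V$ is an irreducible crystallographic root system spanning $V$ (not necessarily reduced), $\Phi^+$ a choice of positive roots, $W_0$ the Weyl group generated by the reflections $s_\alpha x=x-2\frac{\langle\alpha,x\rangle}{\langle\alpha,\alpha\rangle}\alpha$. A multiplicity parameter is a $W_0$-invariant function $k$ on $\Phi$. Set $\rho=\frac12\sum_{\alpha\in\Phi^+}k(\alpha)\alpha$. For $\xi\in V$ and $f\in C^1(V)$ the Dunkl–Cherednik operator is $$D_{k,\xi}f(x)=\partial_\xi f(x)+\sum_{\alpha\in\Phi^+}k(\alpha)\frac{\langle\alpha,\xi\rangle}{1-e^{-\langle\alpha,x\rangle}}\big[f(x)-f(s_\alpha x)\big]-\langle\rho,\xi\rangle f(x).$$ For $s\in V_{\mathbb C}$, the Opdam–Cherednik kernel $G_{k,s}\in C^\infty(V)$ is the unique function with $D_{k,\xi}G_{k,s}=\langle s,\xi\rangle G_{k,s}$ for all $\xi\in V$ and $G_{k,s}(0)=1$. The Heckman–Opdam hypergeometric function is $$F_{k,s}(x)=\frac1{|W_0|}\sum_{w\in W_0}G_{k,s}(w(x)).$$ A function $f:X\to[0,\infty)$ on a convex set $X\subset V$ is log-convex if $f(tx+(1-t)y)\le f(x)^tf(y)^{1-t}$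 for all $x,y\in X$, $t\in(0,1)$. For $x,y\in V$, $x$ $W_0$-majorizes $y$ if $y$ lies in the convex hull of the orbit $W_0\cdot x$. A function $f:V\to\mathbb R$ is $W_0$-convex if $f(x)\ge f(y)$ whenever $x$ $W_0$-majorizes $y$. *)

(* Defs.v *)
From HB Require Import structures.
From mathcomp Require Import all_boot all_order all_algebra finmap.
From mathcomp Require Import all_classical all_reals all_analysis.
From mathcomp Require Import complex.

Set Implicit Arguments.
Unset Strict Implicit.
Unset Printing Implicit Defensive.

Import Order.TTheory GRing.Theory Num.Theory.
Import numFieldNormedType.Exports.

Local Open Scope classical_set_scope.
Local Open Scope fset_scope.
Local Open Scope complex_scope.
Local Open Scope ring_scope.

(** The Euclidean space V is R^n with its standard inner product; the extra
    generality in the scalars serves the complexification. *)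
Definition dot (K : pzRingType) (n : nat) (x y : 'rV[K]_n) : K :=
  \sum_(i < n) x 0 i * y 0 i.

Definition complexify (R : rcfType) (n : nat) (x : 'rV[R]_n) : 'rV[R[i]]_n :=
  map_mx (real_complex R) x.

Section RootSystem.
Context {R : realType} {n : nat}.
Notation V := 'rV[R]_n.
Implicit Types (Phi Pos : {fset V}) (k : V -> R).

Definition reflection (a x : V) : V := x - (2 * dot a x / dot a a) *: a.

(** A crystallographic root system spanning V.  No condition R a `&` Phi =
    {a, -a} is imposed: Phi may be non-reduced. *)
Record root_system Phi : Prop := RootSystem {
  root_neq0 : forall a, a \in Phi -> a != 0;
  root_span : (<<enum_fset Phi>> = fullv)%VS;
  root_reflection : forall a b, a \in Phi -> b \in Phi -> reflection a b \in Phi;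
  root_crystallographic : forall a b, a \in Phi -> b \in Phi ->
    2 * dot a b / dot a a \is a Num.int }.

Definition irreducible_roots Phi : Prop :=
  Phi != fset0 /\
  forall A B : {fset V}, A `|` B = Phi ->
    (forall a b, a \in A -> b \in B -> dot a b = 0) -> A = fset0 \/ B = fset0.

Definition positive_roots Phi Pos : Prop :=
  exists v : V, (forall a, a \in Phi -> dot a v != 0) /\
    Pos = [fset a in Phi | 0 < dot a v].

(** Reflections are involutions, so closing under composition generates the
    whole group. *)
Inductive weyl_group Phi : set (V -> V) :=
| weyl1 : weyl_group Phi id
| weylM a w : a \in Phi -> weyl_group Phi w ->
    weyl_group Phi (reflection a \o w).

(** Only the values of k on Phi matter. *)
Definition multiplicity Phi k : Prop :=
  forall w a, weyl_group Phi w -> a \in Phi -> k (w a) = k a.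

Definition rho Pos k : V := 2^-1 *: \sum_(a <- Pos) k a *: a.

End RootSystem.

Section Cherednik.
Context {R : realType} {n : nat}.
Notation V := 'rV[R]_n.
Implicit Types (Phi Pos : {fset V}) (k : V -> R) (f : V -> R[i]).

Fixpoint Ck (m : nat) (f : V -> R) : Prop :=
  if m is m'.+1 then
    (forall x, differentiable f x) /\ (forall v, Ck m' (fun x => 'D_v f x))
  else continuous f.

Definition smooth f : Prop :=
  forall m, Ck m (fun x => complex.Re (f x)) /\ Ck m (fun x => complex.Im (f x)).

Definition cderive (v : V) f (x : V) : R[i] :=
  'D_v (fun y => complex.Re (f y)) x +i* 'D_v (fun y => complex.Im (f y)) x.

(** [f(x) - f(s_a x)] / (1 - exp(-<a,x>)), extended by continuity to the
    hyperplane <a,x> = 0, where for f of class C^1 the limit is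
    (2 / <a,a>) * (d_a f)(x). *)
Definition difference_quotient (a : V) f (x : V) : R[i] :=
  if dot a x == 0 then (2 / dot a a)%:C * cderive a f x
  else (f x - f (reflection a x)) / (1 - expR (- dot a x))%:C.

Definition dunkl_cherednik Pos k (xi : V) f (x : V) : R[i] :=
  cderive xi f x
  + \sum_(a <- Pos) (k a * dot a xi)%:C * difference_quotient a f x
  - (dot (rho Pos k) xi)%:C * f x.

(** The defining property of the Opdam-Cherednik kernel G_{k,s}, s in V_C. *)
Definition opdam_cherednik_kernel Pos k (s : 'rV[R[i]]_n) f : Prop :=
  [/\ smooth f,
      forall xi x, dunkl_cherednik Pos k xi f x = dot s (complexify xi) * f x
    & f 0 = 1].

(** F_{k,s} for the kernel G = G_{k,s}. *)
Definition heckman_opdam Phi (G : V -> R[i]) (x : V) : R[i] :=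
  (#|` fset_set (weyl_group Phi)|%:R)^-1 *
  \sum_(w \in weyl_group Phi) G (w x).

End Cherednik.

Section Convexity.
Context {R : realType} {n : nat}.
Notation V := 'rV[R]_n.

(** To be used with X convex. *)
Definition log_convex (X : set V) (f : V -> R) : Prop :=
  (forall x, X x -> 0 <= f x) /\
  forall (x y : V) (t : R), X x -> X y -> 0 < t < 1 ->
    f (t *: x + (1 - t) *: y) <= f x `^ t * f y `^ (1 - t).

Definition convex_hull (A : set V) : set V :=
  smallest (fun C : set (convex_lmodType V) => convex_set C) A.

Definition majorizes (Phi : {fset V}) (x y : V) : Prop :=
  convex_hull [set w x | w in weyl_group Phi] y.

Definition weyl_convex (Phi : {fset V}) (f : V -> R) : Prop :=
  forall x y, majorizes Phi x y -> f y <= f x.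

End Convexity.

(* Main.v *)
(** Along a ray t -> t y, the eigenvalue equation of G_s couples the values of
    G_s on the orbit W_0 y into a linear system of ordinary differential
    equations with nonnegative off-diagonal coefficients and a diagonal
    potential <s + rho, y> that is affine in s.  A minimum principle for such
    systems, insensitive to the singularity at t = 0, gives uniqueness, reality
    and positivity of G_s for s in V.  By the inequality of arithmetic and
    geometric means, G_{s1}^th G_{s2}^(1-th) is a supersolution for the
    parameter th s1 + (1-th) s2, so s -> G_s(y) is log-convex; Hoelder's
    inequality transfers this to the average F_s over W_0.

    For W_0-convexity it remains to see that F_{ws} = F_s.  For a simple root a
    the Hecke relation shows that a suitable combination of G_s and
    G_s o s_a solves the system for s_a s, whence F_{s_a s} = F_s.  If w
    preserves the positive roots, G_{ws}(wx) = G_s(x).  Every w reduces to this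
    case after multiplication by simple reflections. *)
Require Import Defs.
From mathcomp Require Import all_boot all_order all_algebra finmap.
From mathcomp Require Import all_classical all_reals all_analysis.
From mathcomp Require Import complex.
From mathcomp Require Import ring lra.

Set Implicit Arguments.
Unset Strict Implicit.
Unset Printing Implicit Defensive.

Import Order.TTheory GRing.Theory Num.Theory.
Import numFieldNormedType.Exports.
Local Open Scope classical_set_scope.
Local Open Scope fset_scope.
Local Open Scope complex_scope.
Local Open Scope ring_scope.

(** * Sums and minima over finite lists *)

Lemma reindex_stable (T : eqType) (W : nmodType) (s : seq T) (u : T -> T)
    (H : T -> W) :
  uniq s -> injective u -> {in s, forall b, u b \in s} ->
  \sum_(b <- s) H (u b) = \sum_(b <- s) H b.
Proof.
move=> us iu hu; rewrite -(big_map u xpredT H); apply: perm_big.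
have umap : uniq (map u s) by rewrite map_inj_uniq.
rewrite uniq_perm //.
have sub : {subset map u s <= s} by move=> _ /mapP[b bs ->]; exact: hu.
by have [] := uniq_min_size umap sub; rewrite ?size_map.
Qed.

(** [P] is a [Prop], decided classically, because one application quantifies over all spectral
    parameters. *)
Lemma seq_argmin (R : realDomainType) (T : eqType) (s : seq T) (P : T -> Prop)
    (f : T -> R) :
  (exists2 x, x \in s & P x) ->
  exists x, [/\ x \in s, P x & forall y, y \in s -> P y -> f x <= f y].
Proof.
elim: s => [[]//|z s IH exP].
have [[x [xs Px hx]]|nex] := pselect (exists x,
   [/\ x \in s, P x & forall y, y \in s -> P y -> f x <= f y]).
  have [Pz|nPz] := pselect (P z); last first.
    exists x; split; rewrite ?in_cons ?xs ?orbT// => y.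
    by rewrite in_cons => /predU1P[->//|]; exact: hx.
  have [xz|/ltW zx] := leP (f x) (f z).
    exists x; split; rewrite ?in_cons ?xs ?orbT// => y.
    by rewrite in_cons => /predU1P[->//|]; exact: hx.
  exists z; split; rewrite ?mem_head// => y.
  by rewrite in_cons => /predU1P[->//|ys Py]; apply: le_trans zx _; exact: hx.
have nP y : y \in s -> ~ P y by move=> ys Py; apply: nex; apply: IH; exists y.
have [Pz|nPz] := pselect (P z); last first.
  by case: exP => x; rewrite in_cons => /predU1P[->//|/nP].
exists z; split; rewrite ?mem_head// => y.
by rewrite in_cons => /predU1P[->//|/nP].
Qed.

(** * One-sided derivatives and the minimum principle *)

Section Analysis.
Context {R : realType}.
Implicit Types (f : R -> R) (t : R).

(** Difference quotients with [h < 0] are nonpositive. Only the left side enters, since a minimum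
    over [[0, t1]] may sit at [t1]. *)
Lemma left_min_derive_le0 f a t0 df : a < t0 -> is_derive t0 1 f df ->
  (forall t, a <= t <= t0 -> f t0 <= f t) -> df <= 0.
Proof.
move=> at0 [dv <-] hmin.
have := dv; rewrite /derivable /derive => /cvg_ex[l hl].
rewrite (cvg_lim _ hl)//.
have := cvg_dnbhs_at_left hl; move=> {}hl.
rewrite -(cvg_lim _ hl)//; apply: limr_le; first by apply/cvg_ex; exists l.
near=> h; apply: mulr_le0_ge0.
  by rewrite invr_le0; apply: ltW; near: h; exact: nbhs_left_lt.
rewrite subr_ge0; apply: hmin; rewrite [h *: 1]mulr1; apply/andP; split.
  by rewrite -lerBlDr; near: h; apply: nbhs_left_ge; rewrite subr_lt0.
by rewrite gerDr; apply: ltW; near: h; exact: nbhs_left_lt.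
Unshelve. all: by end_near.
Qed.

(** After multiplication by exp(-(A + 1) t), a negative minimum over the index
    and the time would be approached from the left with positive slope. *)
Lemma minimum_principle (T : eqType) (s : seq T) (d dd : T -> R -> R) (A : R) :
  {in s, forall i, continuous (d i)} ->
  {in s, forall i, forall t, 0 < t -> is_derive t 1 (d i) (dd i t)} ->
  {in s, forall i, 0 <= d i 0} ->
  (forall i t, i \in s -> 0 < t -> d i t < 0 ->
     {in s, forall j, d i t <= d j t} -> A * d i t <= dd i t) ->
  {in s, forall i, forall t, 0 <= t -> 0 <= d i t}.
Proof.
move=> dc dder d0 hmin i is' t1 t1_ge0; rewrite leNgt; apply/negP => dneg.
pose ex t := expR (- ((A + 1) * t)).
pose e j t := ex t * d j t.
have exc : continuous ex.
  move=> t; apply: continuous_comp; last exact: continuous_expR.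
  by apply: cvgN; apply: cvgM; [exact: cvg_cst|exact: cvg_id].
have ec j : j \in s -> continuous (e j).
  by move=> js t; apply: cvgM; [exact: exc|exact: dc].
(* Minimize over time for each index, then over the finitely many indices. *)
have /choice[m hm] : forall j, exists c, j \in s ->
    c \in `[0, t1] /\ forall t, t \in `[0, t1] -> e j c <= e j t.
  move=> j; have [js|] := boolP (j \in s); last by exists 0.
  have [|c cin hc] := @EVT_min R (e j) 0 t1 t1_ge0.
    by apply: continuous_subspaceT => t; exact: ec.
  by exists c => _; split.
have [|j [js _ hj]] := @seq_argmin R T s (fun=> True) (fun j => e j (m j)).
  by exists i.
have [mj hmj] := hm _ js; set t0 := m j in mj hmj hj.
have t1in : t1 \in `[0, t1] by rewrite in_itv /= t1_ge0 lexx.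
have eneg : e j t0 < 0.
  apply: le_lt_trans (hj _ is' I) _; apply: le_lt_trans ((hm _ is').2 _ t1in) _.
  by rewrite /e pmulr_rlt0 // expR_gt0.
have dneg0 : d j t0 < 0 by move: eneg; rewrite /e pmulr_rlt0 // expR_gt0.
(* The values at time 0 are nonnegative, so the negative minimum lies where the derivative is
   available. *)
have t0_gt0 : 0 < t0.
  rewrite lt_neqAle; move: mj; rewrite in_itv /= => /andP[-> _]; rewrite andbT.
  by apply/eqP => t00; move: dneg0; rewrite -t00 ltNge d0.
have hjmin : {in s, forall k, d j t0 <= d k t0}.
  move=> k ks; have := hj _ ks I; move=> h.
  have := le_trans h ((hm _ ks).2 _ mj).
  by rewrite /e ler_pM2l // expR_gt0.
have hA := hmin _ _ js t0_gt0 dneg0 hjmin.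
have exd : is_derive t0 1 ex (ex t0 * - (A + 1)).
  apply: is_derive1_comp; apply: is_deriveN.
  have /is_derive_eq : is_derive t0 1 ((A + 1) \*: @id R) ((A + 1) *: 1).
    exact: is_deriveZ.
  by apply; rewrite [LHS]mulr1.
have ed := is_deriveM exd (dder _ js _ t0_gt0).
(* This derivative is a positive factor times [dd j t0 - (A + 1) * d j t0], which by [hA] is at
   least [- d j t0 > 0]. *)
have := left_min_derive_le0 t0_gt0 ed.
have -> : ex t0 *: dd j t0 + d j t0 *: (ex t0 * - (A + 1)) =
  ex t0 * (dd j t0 - (A + 1) * d j t0) by rewrite /GRing.scale /=; ring.
have /[swap] /[apply] : (forall t, 0 <= t <= t0 -> (ex * d j) t0 <= (ex * d j) t).
  move=> t /andP[t_ge0 tle]; apply: hmj; rewrite in_itv /= t_ge0 /=.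
  by apply: le_trans tle _; move: mj; rewrite in_itv /= => /andP[].
by rewrite pmulr_rle0 ?expR_gt0//; lra.
Qed.

End Analysis.

(** * Inner product and reflections *)

Section Dot.
Context {R : realType} {n : nat}.
Notation V := 'rV[R]_n.
Implicit Types (x y z a b : V) (c : R).

Lemma dotC x y : dot x y = dot y x.
Proof. by apply: eq_bigr => i _; rewrite mulrC. Qed.

Lemma dotDl x y z : dot (x + y) z = dot x z + dot y z.
Proof. by rewrite -big_split /=; apply: eq_bigr => i _; rewrite mxE mulrDl. Qed.

Lemma dotDr x y z : dot x (y + z) = dot x y + dot x z.
Proof. by rewrite dotC dotDl !(dotC _ x). Qed.

Lemma dotZl c x y : dot (c *: x) y = c * dot x y.
Proof. by rewrite mulr_sumr; apply: eq_bigr => i _; rewrite mxE mulrA. Qed.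

Lemma dotZr c x y : dot x (c *: y) = c * dot x y.
Proof. by rewrite dotC dotZl dotC. Qed.

Lemma dotNl x y : dot (- x) y = - dot x y.
Proof. by rewrite -scaleN1r dotZl mulN1r. Qed.

Lemma dotNr x y : dot x (- y) = - dot x y.
Proof. by rewrite dotC dotNl dotC. Qed.

Lemma dotBl x y z : dot (x - y) z = dot x z - dot y z.
Proof. by rewrite dotDl dotNl. Qed.

Lemma dotBr x y z : dot x (y - z) = dot x y - dot x z.
Proof. by rewrite dotDr dotNr. Qed.

Lemma dot0l x : dot 0 x = 0.
Proof. by rewrite -(scale0r 0) dotZl mul0r. Qed.

Lemma dot_suml (I : Type) (s : seq I) (F : I -> V) x :
  dot (\sum_(i <- s) F i) x = \sum_(i <- s) dot (F i) x.
Proof.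
apply: (big_morph (fun y => dot y x)) => [y z|]; first exact: dotDl.
exact: dot0l.
Qed.

Lemma dot_ge0 x : 0 <= dot x x.
Proof. by apply: sumr_ge0 => i _; rewrite -expr2 sqr_ge0. Qed.

Lemma dot_eq0 x : dot x x = 0 -> x = 0.
Proof.
move=> x0; apply/rowP => i; rewrite mxE; apply/eqP; rewrite -sqrf_eq0 expr2.
move: x0 => /eqP; rewrite psumr_eq0; last first.
  by move=> j _; rewrite -expr2 sqr_ge0.
by move=> /allP /(_ i); rewrite mem_index_enum => /(_ isT).
Qed.

Lemma dot_gt0 x : x != 0 -> 0 < dot x x.
Proof.
move=> x0; rewrite lt_neqAle dot_ge0 andbT eq_sym.
by apply: contraNneq x0 => /dot_eq0 ->.
Qed.

Lemma dot_neq0 x : x != 0 -> dot x x != 0.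
Proof. by move=> /dot_gt0; rewrite lt0r => /andP[]. Qed.

Lemma reflectionD a x y : reflection a (x + y) = reflection a x + reflection a y.
Proof.
rewrite /reflection dotDr mulrDr mulrDl scalerDl opprD.
by rewrite addrACA.
Qed.

Lemma reflectionZ a c x : reflection a (c *: x) = c *: reflection a x.
Proof. by rewrite /reflection dotZr scalerBr scalerA -!mulrA [2 * (c * _)]mulrCA. Qed.

Lemma reflectionN a x : reflection a (- x) = - reflection a x.
Proof. by rewrite -scaleN1r reflectionZ scaleN1r. Qed.

Lemma dot_reflection a x y : a != 0 ->
  dot (reflection a x) (reflection a y) = dot x y.
Proof.
move=> /dot_neq0 a0; rewrite /reflection !(dotBl, dotBr, dotZl, dotZr) (dotC x a).
by field.
Qed.

Lemma reflection_self a : a != 0 -> reflection a a = - a.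
Proof.
move=> /dot_neq0 a0; rewrite /reflection mulfK// -{1}(scale1r a) -scalerBl.
by rewrite (_ : 1 - 2 = -1) ?scaleN1r//; ring.
Qed.

Lemma reflectionK a : a != 0 -> involutive (reflection a).
Proof.
move=> a0 x; rewrite {2}/reflection reflectionD reflectionN reflectionZ.
by rewrite reflection_self// scalerN opprK /reflection subrK.
Qed.

Lemma reflectionZl c a : c != 0 -> reflection (c *: a) =1 reflection a.
Proof.
move=> c0 x; rewrite /reflection !(dotZl, dotZr) scalerA.
have [->|/dot_neq0 a0] := eqVneq a 0; first by rewrite !scaler0.
suff -> : 2 * (c * dot a x) / (c * (c * dot a a)) * c = 2 * dot a x / dot a a by [].
by field; rewrite a0.
Qed.

Lemma dot_reflection_sym a x y : dot (reflection a x) y = dot x (reflection a y).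
Proof. by rewrite /reflection !(dotBl, dotBr, dotZl, dotZr) (dotC x a); ring. Qed.

End Dot.

(** * The Weyl group as a finite group of linear isometries *)

Section Weyl.
Context {R : realType} {n : nat} (Phi : {fset 'rV[R]_n}) (hPhi : root_system Phi).
Notation V := 'rV[R]_n.
Notation W := (weyl_group Phi).
Implicit Types (x y a b : V) (w u : V -> V).

Lemma weyl_reflection a : a \in Phi -> W (reflection a).
Proof. by move=> aP; exact: (weylM aP (weyl1 Phi)). Qed.

Lemma weyl_comp u w : W u -> W w -> W (u \o w).
Proof. by move=> Wu Ww; elim: Wu => // a u' aP _ IH; exact: (weylM aP IH). Qed.

Lemma weylD w : W w -> forall x y, w (x + y) = w x + w y.
Proof. by elim=> // a u _ _ IH x y /=; rewrite IH reflectionD. Qed.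

Lemma weylZ w : W w -> forall c x, w (c *: x) = c *: w x.
Proof. by elim=> // a u _ _ IH c x /=; rewrite IH reflectionZ. Qed.

Lemma weylN w : W w -> forall x, w (- x) = - w x.
Proof. by move=> Ww x; rewrite -scaleN1r (weylZ Ww) scaleN1r. Qed.

Lemma weyl_dot w : W w -> forall x y, dot (w x) (w y) = dot x y.
Proof.
elim=> // a u aP _ IH x y /=; rewrite dot_reflection ?IH//.
exact: root_neq0 aP.
Qed.

Lemma weyl_inj w : W w -> injective w.
Proof.
move=> Ww x y wxy; apply/eqP; rewrite -subr_eq0; apply/eqP/dot_eq0.
by rewrite -(weyl_dot Ww) (weylD Ww) (weylN Ww) wxy subrr dot0l.
Qed.

Lemma weyl_root w : W w -> forall a, a \in Phi -> w a \in Phi.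
Proof. by elim=> // a u aP _ IH b bP /=; apply: root_reflection => //; exact: IH. Qed.

Lemma weyl_conj w b x : W w -> reflection (w b) (w x) = w (reflection b x).
Proof.
by move=> Ww; rewrite /reflection !(weyl_dot Ww) (weylD Ww) (weylN Ww) (weylZ Ww).
Qed.

Lemma root_opp a : a \in Phi -> - a \in Phi.
Proof.
move=> aP; rewrite -reflection_self; last exact: root_neq0 aP.
exact: root_reflection.
Qed.

Lemma weyl_ext u w : W u -> W w -> {in Phi, u =1 w} -> u = w.
Proof.
move=> Wu Ww uw; apply/funext => x.
have xs : x \in <<in_tuple (enum_fset Phi)>>%VS by rewrite root_span ?memvf.
rewrite (coord_span xs).
have sumE v : W v -> forall F : 'I_(size (enum_fset Phi)) -> V,
    v (\sum_i F i) = \sum_i v (F i).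
  move=> Wv F; apply: (big_morph v (weylD Wv)).
  by rewrite -[X in v X](scale0r (0 : V)) (weylZ Wv) scale0r.
rewrite !sumE//; apply: eq_bigr => i _; rewrite (weylZ Wu) (weylZ Ww); congr (_ *: _).
by apply: uw; rewrite mem_nth.
Qed.

(** The roots span, so a group element is determined by the self-map it induces on [Phi]. [ext]
    recovers it, with default [id] for self-maps that no element induces. *)
Lemma finite_weyl : finite_set W.
Proof.
pose ext (f : {ffun Phi -> Phi}) : V -> V :=
  xget (id : V -> V) [set w | W w /\ forall b : Phi, w (val b) = val (f b)].
apply: (@sub_finite_set _ _ (range ext)); last first.
  by apply: finite_image; exact: finite_finset.
move=> w Ww; pose f := [ffun b : Phi => [` weyl_root Ww (valP b)] : Phi].
exists f => //; apply: (@xget_subset1 _ _ _ w) => [|u v [Wu hu] [Wv hv]].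
  by split => // b; rewrite ffunE.
by apply: weyl_ext => // b bP; rewrite (hu [` bP]) (hv [` bP]).
Qed.

Definition weyl_seq : seq (V -> V) := enum_fset (fset_set W).

Lemma mem_weyl_seq w : (w \in weyl_seq) = (w \in W).
Proof. by rewrite /weyl_seq in_fset_set //; exact: finite_weyl. Qed.

Lemma sum_weyl_comp (M : nmodType) u (H : (V -> V) -> M) : W u ->
  \sum_(w <- weyl_seq) H (u \o w) = \sum_(w <- weyl_seq) H w.
Proof.
move=> Wu; apply: reindex_stable => [|w v uwv|w]; first exact: fset_uniq.
  apply/funext => x; apply: (weyl_inj Wu).
  by have := congr1 (fun g => g x) uwv.
rewrite !mem_weyl_seq !inE; exact: weyl_comp.
Qed.

End Weyl.

(** Convexity of the exponential between [ln a] and [ln b]. *)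
Lemma weighted_am_gm (R : realType) (t a b : R) : 0 < t < 1 -> 0 < a -> 0 < b ->
  a `^ t * b `^ (1 - t) <= t * a + (1 - t) * b.
Proof.
move=> /andP[t0 t1] a0 b0; rewrite /powR !gt_eqF// -expRD.
have t01 : Itv.spec (@Itv.num_sem R) (Itv.Real `[0%Z, 1%Z]) t.
  by apply/and3P; split; rewrite ?num_real//= !bnd_simp ?ltW.
have := convex_expR (Itv.mk t01) (ln a) (ln b).
by rewrite !convRE /= !lnK ?posrE.
Qed.

(** * Comparison, uniqueness and positivity for the radial system *)

Section Radial.
Context {R : realType} {n : nat} (Phi Pos : {fset 'rV[R]_n}).
Context (k : 'rV[R]_n -> R).
Hypotheses (hPhi : root_system Phi) (hk0 : forall a, a \in Phi -> 0 <= k a).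
Hypothesis sPos : {subset Pos <= Phi}.
Notation V := 'rV[R]_n.
Notation W := (weyl_group Phi).
Implicit Types (x y a b s : V) (w u : V -> V) (t : R).

Definition rate b t y := k b * (dot b y / (1 - expR (- (t * dot b y)))).

(** Along the ray through [y] the Dunkl-Cherednik equation at [t *: y] in the
    direction [y] reads [g' = radial_rhs s t g]; for [dot b y = 0] the rate is
    [0 / 0 = 0], in accordance with the vanishing factor [dot b xi]. *)
Definition radial_rhs s t (F : V -> R) y : R :=
  dot (s + rho Pos k) y * F y
  + \sum_(b <- Pos) rate b t y * (F (reflection b y) - F y).

(** The true coefficients have a pole at [t = 0], so the equation is imposed for [t > 0] only, and
    continuity carries the initial value. *)
Definition radial_solution s (g : V -> R) : Prop :=
  (forall y, continuous (fun t => g (t *: y))) /\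
  (forall y t, 0 < t -> is_derive t 1 (fun t => g (t *: y))
     (radial_rhs s t (fun z => g (t *: z)) y)).

(** Numerator and denominator both have the sign of [dot b y]. *)
Lemma rate_ge0 b t y : b \in Pos -> 0 < t -> 0 <= rate b t y.
Proof.
move=> bP t0; apply: mulr_ge0; first by apply: hk0; exact: sPos.
have [u0|u0|->] := ltgtP (dot b y) 0; last by rewrite mul0r.
- rewrite -mulrNN -invrN mulr_ge0 ?oppr_ge0 ?(ltW u0)//.
  by rewrite invr_ge0 opprB subr_ge0 -expR0 ler_expR oppr_ge0 ltW // pmulr_rlt0.
- rewrite mulr_ge0 ?(ltW u0)// invr_ge0 subr_ge0 -expR0 ler_expR oppr_le0.
  by rewrite ltW // mulr_gt0.
Qed.

Lemma radial_rhsB s t F1 F2 y :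
  radial_rhs s t (fun z => F1 z - F2 z) y =
  radial_rhs s t F1 y - radial_rhs s t F2 y.
Proof.
rewrite /radial_rhs [in RHS]opprD [RHS]addrACA -sumrB mulrBr; congr (_ + _).
by apply: eq_bigr => b _; ring.
Qed.

(** The system closes on the orbit of [y]. At a negative minimum over the orbit the reflection terms
    are nonnegative, and the potential, bounded there by [A], contributes at least [A] times the
    value. *)
Lemma radial_comparison s y (d dd : V -> R -> R) :
  (forall w, W w -> continuous (d (w y))) ->
  (forall w t, W w -> 0 < t -> is_derive t 1 (d (w y)) (dd (w y) t)) ->
  (forall w, W w -> 0 <= d (w y) 0) ->
  (forall w t, W w -> 0 < t -> radial_rhs s t (d^~ t) (w y) <= dd (w y) t) ->
  forall t, 0 <= t -> 0 <= d y t.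
Proof.
move=> dc dder d0 dsup t t0.
have memW w : w \in weyl_seq Phi -> W w by rewrite mem_weyl_seq// inE.
pose A := \sum_(w <- weyl_seq Phi) `|dot (s + rho Pos k) (w y)|.
apply: (@minimum_principle _ _ (weyl_seq Phi) (fun w => d (w y))
    (fun w => dd (w y)) A _ _ _ _ id _ t t0).
- by move=> w /memW; exact: dc.
- by move=> w /memW Ww u u0; exact: dder.
- by move=> w /memW; exact: d0.
- move=> w u wW u0 dneg hmin; have Ww := memW _ wW.
  apply: le_trans (dsup _ _ Ww u0); rewrite /radial_rhs -[leLHS]addr0.
  apply: lerD.
    rewrite ler_nM2r//; apply: le_trans (ler_norm _) _.
    by rewrite /A (big_rem w)//= lerDl sumr_ge0.
  rewrite big_seq; apply: sumr_ge0 => b bP; apply: mulr_ge0; first exact: rate_ge0.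
  rewrite subr_ge0; apply: (hmin (reflection b \o w)).
  by rewrite mem_weyl_seq// inE; apply: weylM => //; exact: sPos.
- by rewrite mem_weyl_seq// inE; exact: weyl1.
Qed.

Lemma radial_solution_le s f g : radial_solution s f -> radial_solution s g ->
  g 0 <= f 0 -> forall y, g y <= f y.
Proof.
move=> [fc fd] [gc gd] gf0 y; rewrite -subr_ge0.
rewrite -[y]scale1r.
apply: (@radial_comparison s y (fun y t => f (t *: y) - g (t *: y))
  (fun y t => radial_rhs s t (fun z => f (t *: z)) y
            - radial_rhs s t (fun z => g (t *: z)) y)) => //.
- by move=> w _ t; apply: cvgB; [exact: fc|exact: gc].
- by move=> w t _ t0; apply: is_deriveB; [exact: fd|exact: gd].
- by move=> w _; rewrite !scale0r subr_ge0.
- by move=> w t _ t0; rewrite radial_rhsB.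
Qed.

Lemma radial_solution_unique s f g : radial_solution s f -> radial_solution s g ->
  g 0 = f 0 -> g = f.
Proof.
move=> hf hg gf0; apply/funext => y; apply/le_anti/andP.
by split; [apply: (radial_solution_le hf hg)|apply: (radial_solution_le hg hf)];
  rewrite gf0.
Qed.

(** Comparison with [expR (- (K * t))]: it is constant on the orbit, so its reflection terms vanish,
    and [- K] lies below the potential, which makes it a subsolution. *)
Lemma radial_solution_gt0 s g : radial_solution s g -> g 0 = 1 ->
  forall y, 0 < g y.
Proof.
move=> [gc gd] g0 y.
pose K := \sum_(w <- weyl_seq Phi) `|dot (s + rho Pos k) (w y)|.
have KE w : W w -> - dot (s + rho Pos k) (w y) <= K.
  move=> Ww; apply: le_trans (ler_norm _) _.
  rewrite normrN /K (big_rem w)/= ?lerDl ?sumr_ge0//.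
  by rewrite mem_weyl_seq// inE.
suff : 0 <= g (1 *: y) - expR (- (K * 1)).
  by rewrite scale1r subr_ge0; apply: lt_le_trans; exact: expR_gt0.
apply: (@radial_comparison s y (fun y t => g (t *: y) - expR (- (K * t)))
  (fun y t => radial_rhs s t (fun z => g (t *: z)) y
            - expR (- (K * t)) * - K)) => //.
- move=> w _ t; apply: cvgB; first exact: gc.
  apply: continuous_comp; last exact: continuous_expR.
  by apply: cvgN; apply: cvgM; [exact: cvg_cst|exact: cvg_id].
- move=> w t _ t0; apply: is_deriveB; first exact: gd.
  apply: is_derive1_comp; apply: is_deriveN.
  have /is_derive_eq : is_derive t 1 (K \*: @id R) (K *: 1) by exact: is_deriveZ.
  by apply; rewrite [LHS]mulr1.
- by move=> w _; rewrite scale0r g0 mulr0 oppr0 expR0 subrr.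
- move=> w t Ww t0; rewrite radial_rhsB lerD2l lerN2 /radial_rhs.
  rewrite big1 ?addr0; last by move=> b _; rewrite subrr mulr0.
  rewrite mulrC ler_pM2r ?expR_gt0// lerNl.
  exact: KE.
Qed.

(** By the weighted arithmetic-geometric mean inequality the geometric mean of
    two solutions is a supersolution for the mean spectral parameter. *)
Lemma radial_solution_log_convex s1 s2 th g1 g2 g : 0 < th < 1 ->
  radial_solution s1 g1 -> radial_solution s2 g2 ->
  radial_solution (th *: s1 + (1 - th) *: s2) g ->
  g1 0 = 1 -> g2 0 = 1 -> g 0 = 1 ->
  forall y, g y <= g1 y `^ th * g2 y `^ (1 - th).
Proof.
move=> th01 h1 h2 h g10 g20 g0 y.
have p1 := radial_solution_gt0 h1 g10; have p2 := radial_solution_gt0 h2 g20.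
pose psi z := expR (th * ln (g1 z) + (1 - th) * ln (g2 z)).
have -> : g1 y `^ th * g2 y `^ (1 - th) = psi y.
  by rewrite /powR !gt_eqF// /psi expRD.
(* The mean inequality for the two ratios; below, [a] is the current point and [b] its
   reflection. *)
have psiP a b : psi b <= (th * (g1 b / g1 a) + (1 - th) * (g2 b / g2 a)) * psi a.
  rewrite -ler_pdivrMr ?expR_gt0//.
  apply: le_trans (weighted_am_gm th01 _ _); rewrite ?divr_gt0//.
  rewrite /powR !gt_eqF ?divr_gt0// /psi -expRN -!expRD !ln_div ?posrE//.
  by rewrite ler_expR le_eqVlt; apply/orP; left; apply/eqP; ring.
rewrite -subr_ge0 -[y]scale1r.
apply: (@radial_comparison (th *: s1 + (1 - th) *: s2) y
  (fun y t => psi (t *: y) - g (t *: y))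
  (fun y t => psi (t *: y) *
     (th * ((g1 (t *: y))^-1 * radial_rhs s1 t (fun z => g1 (t *: z)) y)
      + (1 - th) * ((g2 (t *: y))^-1 * radial_rhs s2 t (fun z => g2 (t *: z)) y))
   - radial_rhs (th *: s1 + (1 - th) *: s2) t (fun z => g (t *: z)) y)) => //.
- move=> w _ t; apply: cvgB; last exact: h.1.
  apply: (@continuous_comp _ _ _ (fun t =>
    th * ln (g1 (t *: w y)) + (1 - th) * ln (g2 (t *: w y))) expR);
    last exact: continuous_expR.
  have lnc g' s' : radial_solution s' g' -> (forall z, 0 < g' z) ->
      {for t, continuous (@ln R \o (fun t => g' (t *: w y)))}.
    move=> hg' gp'; apply: (@continuous_comp _ _ _ (fun t => g' (t *: w y)) (@ln R)).
      exact: hg'.1.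
    exact: continuous_ln.
  apply: cvgD; (apply: cvgM; first exact: cvg_cst); last exact: lnc h2 p2.
  exact: lnc h1 p1.
- move=> w t _ t0; apply: is_deriveB; last exact: h.2.
  apply: (@is_derive1_comp _ expR (fun t =>
    th * ln (g1 (t *: w y)) + (1 - th) * ln (g2 (t *: w y)))).
  apply: is_deriveD; apply: is_deriveZ.
    apply: (@is_derive1_comp _ (@ln R) (fun t => g1 (t *: w y))); last exact: h1.2.
    exact: is_derive1_ln.
  apply: (@is_derive1_comp _ (@ln R) (fun t => g2 (t *: w y))); last exact: h2.2.
  exact: is_derive1_ln.
- move=> w _; rewrite scale0r g0 /psi g10 g20 ln1 !mulr0 addr0 expR0.
  by rewrite subrr.
- move=> w t Ww t0; rewrite radial_rhsB lerD2r /radial_rhs.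
  set z := w y; set m1 := \sum_(b <- Pos) _; set m2 := \sum_(b <- Pos) _.
  set m3 := \sum_(b <- Pos) _.
  (* The potential is affine in the spectral parameter, so the diagonal terms match exactly and only
     the reflection terms need an inequality. *)
  have -> : psi (t *: z) * (th * ((g1 (t *: z))^-1 *
        (dot (s1 + rho Pos k) z * g1 (t *: z) + m2)) + (1 - th) *
      ((g2 (t *: z))^-1 * (dot (s2 + rho Pos k) z * g2 (t *: z) + m3))) =
    dot (th *: s1 + (1 - th) *: s2 + rho Pos k) z * psi (t *: z) +
    psi (t *: z) * (th * (m2 / g1 (t *: z)) + (1 - th) * (m3 / g2 (t *: z))).
    rewrite !(dotDl, dotZl); field.
    by rewrite !gt_eqF.
  rewrite lerD2l /m2 /m3 !mulr_suml !mulr_sumr -big_split/= mulr_sumr.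
  rewrite /m1 big_seq [leRHS]big_seq; apply: ler_sum => b bP.
  have -> : psi (t *: z) *
     (th * (rate b t z * (g1 (t *: reflection b z) - g1 (t *: z)) / g1 (t *: z)) +
      (1 - th) * (rate b t z * (g2 (t *: reflection b z) - g2 (t *: z)) / g2 (t *: z)))
    = rate b t z * ((th * (g1 (t *: reflection b z) / g1 (t *: z)) +
       (1 - th) * (g2 (t *: reflection b z) / g2 (t *: z))) * psi (t *: z)
       - psi (t *: z)).
    by field; rewrite !gt_eqF.
  by apply: ler_wpM2l; [exact: rate_ge0|rewrite lerD2r].
Qed.

End Radial.

(** * Positive roots and simple roots *)

Section Symmetry.
Context {R : realType} {n : nat} (Phi Pos : {fset 'rV[R]_n}).
Context (k : 'rV[R]_n -> R) (v : 'rV[R]_n).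
Hypotheses (hPhi : root_system Phi) (hk : multiplicity Phi k).
Hypotheses (hk0 : forall a, a \in Phi -> 0 <= k a).
Hypotheses (hv : forall a, a \in Phi -> dot a v != 0).
Hypothesis mem_Pos : forall a, (a \in Pos) = (a \in Phi) && (0 < dot a v).
Notation V := 'rV[R]_n.
Notation W := (weyl_group Phi).
Implicit Types (x y z a b c s : V) (w u : V -> V) (t : R) (F : V -> R).

Lemma pos_root : {subset Pos <= Phi}.
Proof. by move=> a; rewrite mem_Pos => /andP[]. Qed.
Let sPos := pos_root.

Lemma pos_neq0 a : a \in Pos -> a != 0.
Proof. by move=> /sPos; exact: root_neq0. Qed.

Lemma pos_or_neg a : a \in Phi -> a \notin Pos -> - a \in Pos.
Proof.
move=> aP; rewrite !mem_Pos aP /= root_opp//= dotNl oppr_gt0 -leNgt => h.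
by rewrite lt_neqAle hv.
Qed.

(** The exceptional roots [b] are exactly the multiples of [a]. In the non-reduced case both [a] and
    [2 a] may qualify. *)
Definition simple_root a : Prop :=
  a \in Pos /\
  {in Pos, forall b, (reflection a b \in Pos) || (reflection a b == - b)}.

(** Rescale the positive roots to the hyperplane [dot b v = 1]; a root
    minimizing [dot b z] there, and farthest from the origin among the
    minimizers, is extremal: if its reflection makes the positive root [c]
    negative, it lies on the segment between [c] and [- reflection b c]. *)
Lemma simple_root_exists z b : b \in Pos -> dot b z < 0 ->
  exists2 a, simple_root a & dot a z < 0.
Proof.
move=> bP bz.
have [|b1 [b1P _ min1]] := @seq_argmin _ _ (enum_fset Pos) (fun=> True)
    (fun b => dot b z / dot b v); first by exists b.
pose m := dot b1 z / dot b1 v.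
have [|a [aP am min2]] := @seq_argmin _ _ (enum_fset Pos)
    (fun b => dot b z / dot b v = m) (fun b => - (dot b b / dot b v ^+ 2)).
  by exists b1.
have v0 c : c \in Pos -> 0 < dot c v by rewrite mem_Pos => /andP[].
have zm c : c \in Pos -> m * dot c v <= dot c z.
  by move=> cP; rewrite -ler_pdivlMr ?v0//; exact: min1.
have az : dot a z = m * dot a v by rewrite -am divfK// gt_eqF// v0.
exists a; last first.
  rewrite az pmulr_llt0 ?v0//; apply: le_lt_trans (min1 _ bP I) _.
  by rewrite pmulr_llt0// invr_gt0 v0.
split=> // c cP; apply/orP.
have [scP|scN] := boolP (reflection a c \in Pos); [by left|right].
have {scN} dP := pos_or_neg (root_reflection hPhi (sPos aP) (sPos cP)) scN.
set d := - reflection a c in dP.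
pose N := 2 * dot a c / dot a a.
have cd : c + d = N *: a by rewrite /d /reflection opprB addrC subrK.
have cdz : dot c z + dot d z = N * dot a z by rewrite -dotDl cd dotZl.
have cdv : dot c v + dot d v = N * dot a v by rewrite -dotDl cd dotZl.
(* [c] and [d] both have ratio at least [m], while their sum is a multiple of [a], of ratio [m]; so
   equality holds for both. *)
have cz : dot c z = m * dot c v.
  apply/le_anti; rewrite zm// andbT.
  have := zm d dP; have -> : dot d v = N * dot a v - dot c v by rewrite -cdv; ring.
  have -> : dot d z = N * (m * dot a v) - dot c z by rewrite -az -cdz; ring.
  by move=> h; rewrite -subr_ge0; move: h; rewrite -subr_ge0; congr (0 <= _); ring.
have dz : dot d z = m * dot d v.
  by apply: (addrI (dot c z)); rewrite cdz az cz -mulrDr cdv; ring.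
have norm_d : dot d d = dot c c.
  by rewrite /d dotNl dotNr opprK dot_reflection// pos_neq0.
pose B := dot a a / dot a v ^+ 2.
have far e : e \in Pos -> dot e z = m * dot e v -> dot e e <= B * dot e v ^+ 2.
  move=> eP ez; rewrite -ler_pdivrMr ?exprn_gt0 ?v0//.
  by rewrite -lerN2; apply: min2 => //; rewrite ez mulfK// gt_eqF// v0.
have hc := far c cP cz; have := far d dP dz; rewrite norm_d => hd.
have B0 : 0 <= B by rewrite divr_ge0 ?dot_ge0// exprn_ge0// ltW// v0.
have hcd : dot c c <= B * (dot c v * dot d v).
  have [le|/ltW le] := leP (dot c v) (dot d v).
    by apply: le_trans hc _; rewrite ler_wpM2l// expr2 ler_wpM2l// ltW// v0.
  by apply: le_trans hd _; rewrite ler_wpM2l// expr2 ler_wpM2r// ltW// v0.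
have hN : dot c c + dot c d *+ 2 + dot d d = B * (dot c v + dot d v) ^+ 2.
  have -> : dot c c + dot c d *+ 2 + dot d d = dot (c + d) (c + d).
    by rewrite !(dotDl, dotDr) (dotC d c); ring.
  by rewrite cd dotZl dotZr cdv /B; field; rewrite gt_eqF// v0.
(* Parallelogram law: [c] and [d] have equal norm, and [hcd], [hN] leave no room for a positive
   [dot (c - d) (c - d)]. Then [c = d], that is, [reflection a c = - c]. *)
have : dot (c - d) (c - d) = 0.
  apply/le_anti; rewrite dot_ge0 andbT.
  have -> : dot (c - d) (c - d) = dot c c *+ 4 -
      (dot c c + dot c d *+ 2 + dot d d).
    by rewrite !(dotBl, dotBr) (dotC d c) norm_d; ring.
  rewrite hN subr_le0.
  have -> : B * (dot c v + dot d v) ^+ 2 = B * dot c v ^+ 2 + B * dot d v ^+ 2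
     + (B * (dot c v * dot d v)) *+ 2 by ring.
  have -> : dot c c *+ 4 = dot c c + dot c c + dot c c *+ 2 by ring.
  by rewrite !lerD// lerMn2r hcd.
move=> /dot_eq0 /eqP; rewrite subr_eq0 => /eqP cE.
by rewrite [X in _ == - X]cE /d opprK.
Qed.

(** * The Hecke relation for a simple root *)

Section Hecke.
Context (a : V) (ha : simple_root a).
Let aP : a \in Pos := ha.1.
Let a0 : a != 0 := pos_neq0 aP.
Notation sg := (reflection a).
Let par b := sg b == - b.

(** For reduced [Phi] this is [k a]; if [2 a] is a root, it is [k a + 2 k (2 a)]. *)
Definition hecke_coef : R :=
  \sum_(b <- Pos | sg b == - b) k b * (dot a b / dot a a).

Lemma parE b : par b -> b = (dot a b / dot a a) *: a.
Proof.
move=> /eqP; rewrite /reflection => /(congr1 (fun x => x + b)).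
rewrite addNr addrAC => /eqP; rewrite subr_eq0 => /eqP b2.
apply: (@scalerI _ _ (2 : R)); first by rewrite pnatr_eq0.
by rewrite scalerA mulrA -b2 scaler_nat mulr2n.
Qed.

Lemma par_gt0 b : b \in Pos -> par b -> 0 < dot a b / dot a a.
Proof.
move=> bP /parE bE; have := bP; rewrite mem_Pos {1 2}bE dotZl => /andP[_].
by rewrite pmulr_lgt0//; move: aP; rewrite mem_Pos => /andP[].
Qed.

Lemma hecke_coef_ge0 : 0 <= hecke_coef.
Proof.
rewrite /hecke_coef big_seq_cond; apply: sumr_ge0 => b /andP[bP pb].
by rewrite mulr_ge0 ?hk0 ?(sPos bP)// ltW// par_gt0.
Qed.

Lemma hecke_coefE y :
  \sum_(b <- Pos | par b) k b * dot b y = hecke_coef * dot a y.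
Proof.
rewrite /hecke_coef mulr_suml; apply: eq_bigr => b pb.
by rewrite [X in _ * dot X y](parE pb) dotZl mulrA.
Qed.

Lemma k_reflection b : b \in Phi -> k (sg b) = k b.
Proof. by move=> bP; rewrite (hk (weyl_reflection (sPos aP)) bP). Qed.

(** A simple reflection permutes the positive roots not proportional to its root. *)
Lemma sum_simple (H : V -> R) :
  \sum_(b <- Pos | ~~ par b) H (sg b) = \sum_(b <- Pos | ~~ par b) H b.
Proof.
rewrite -!(big_filter _ (fun b => ~~ par b)); apply: reindex_stable.
- by rewrite filter_uniq// fset_uniq.
- exact/inv_inj/reflectionK.
- move=> b; rewrite !mem_filter => /andP[npb bP].
  have := ha.2 b bP; rewrite -/(par b) (negbTE npb) orbF => ->; rewrite andbT.
  by apply: contraNN npb; rewrite /par reflectionK// -eqr_oppLR eq_sym.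
Qed.

Lemma dot_rho y : dot (rho Pos k) y = 2^-1 * \sum_(b <- Pos) k b * dot b y.
Proof.
rewrite /rho dotZl dot_suml; congr (_ * _).
by apply: eq_bigr => b _; rewrite dotZl.
Qed.

(** In the half sum [rho], the non-proportional roots are permuted and the proportional ones change
    sign. *)
Lemma dot_rho_reflection y :
  dot (rho Pos k) (sg y) = dot (rho Pos k) y - hecke_coef * dot a y.
Proof.
rewrite !dot_rho -hecke_coefE !(bigID par (fun=> true))/=.
rewrite -(sum_simple (fun b => k b * dot b (sg y))).
have -> : \sum_(b <- Pos | ~~ par b) k (sg b) * dot (sg b) (sg y) =
    \sum_(b <- Pos | ~~ par b) k b * dot b y.
  rewrite big_seq_cond [RHS]big_seq_cond; apply: eq_bigr => b /andP[bP _].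
  by rewrite k_reflection ?(sPos bP)// dot_reflection.
have -> : \sum_(b <- Pos | par b) k b * dot b (sg y) =
    - \sum_(b <- Pos | par b) k b * dot b y.
  rewrite -sumrN; apply: eq_bigr => b /eqP pb.
  by rewrite -dot_reflection_sym pb dotNl mulrN.
by field.
Qed.

(** From [1 / (1 - exp(-u)) + 1 / (1 - exp(u)) = 1]. This asymmetry is one source of the Hecke
    correction. *)
Lemma rate_opp b t y y' : 0 < t -> dot b y' = - dot b y ->
  rate k b t y' = rate k b t y - k b * dot b y.
Proof.
move=> t0; rewrite /rate => ->.
rewrite -mulrBr; congr (_ * _); set d := dot b y.
have [->|d0] := eqVneq d 0; first by rewrite !(oppr0, mul0r, addr0).
rewrite mulrN opprK expRN.
have e0 : expR (t * d) != 0 by rewrite gt_eqF// expR_gt0.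
have e1 : 1 - expR (t * d) != 0.
  by rewrite subr_eq0 eq_sym -expR0 (inj_eq (@expR_inj R)) mulf_neq0// gt_eqF.
have e2 : expR (t * d) - 1 != 0 by rewrite -opprB oppr_eq0.
by field; rewrite e0 e1 e2.
Qed.

(** The graded Hecke relation between [reflection a] and the Dunkl-Cherednik
    operators. *)
Lemma radial_rhs_reflection s t F y : 0 < t ->
  radial_rhs Pos k s t F (sg y) =
  radial_rhs Pos k (sg s) t (F \o sg) y - hecke_coef * dot a y * F y.
Proof.
move=> t0; rewrite /radial_rhs !(bigID par xpredT)/=.
rewrite -(sum_simple (fun b => rate k b t (sg y) * _)).
have -> : \sum_(b <- Pos | ~~ par b)
      rate k (sg b) t (sg y) * (F (reflection (sg b) (sg y)) - F (sg y)) =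
    \sum_(b <- Pos | ~~ par b)
      rate k b t y * (F (sg (reflection b y)) - F (sg y)).
  rewrite big_seq_cond [RHS]big_seq_cond; apply: eq_bigr => b /andP[bP _].
  rewrite (weyl_conj hPhi _ _ (weyl_reflection (sPos aP))) /rate.
  by rewrite k_reflection ?(sPos bP)// dot_reflection.
have -> : \sum_(b <- Pos | par b)
      rate k b t (sg y) * (F (reflection b (sg y)) - F (sg y)) =
    \sum_(b <- Pos | par b)
      rate k b t y * (F (sg (reflection b y)) - F (sg y))
    - hecke_coef * dot a y * (F y - F (sg y)).
  rewrite -hecke_coefE mulr_suml -sumrB.
  rewrite big_seq_cond [RHS]big_seq_cond; apply: eq_bigr => b /andP[bP pb].
  have refl_b : reflection b =1 sg.
    by move=> z; rewrite (parE pb) reflectionZl// gt_eqF// par_gt0.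
  rewrite !refl_b !reflectionK// (@rate_opp b t y)//; first by ring.
  by rewrite -dot_reflection_sym (eqP pb) dotNl.
(* The shift of [rho] cancels the [F (sg y)] part of the correction from the proportional roots,
   leaving the [F y] part. *)
rewrite dotDl dot_rho_reflection -dot_reflection_sym (dotDl (sg s)).
by ring.
Qed.

(** The first summand leaves the Hecke correction as error, the second the change of potential from
    [s] to [sg s]; the condition on [p] and [q] makes them cancel. *)
Lemma radial_solution_hecke s p q f : radial_solution Pos k s f ->
  (forall y, q * dot (s - sg s) y = p * (hecke_coef * dot a y)) ->
  radial_solution Pos k (sg s) (fun y => p * f (sg y) + q * f y).
Proof.
move=> [fc fd] hpq; split => [y|y t t0].
  move=> t; apply: cvgD; (apply: cvgM; first exact: cvg_cst); last exact: fc.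
  rewrite [X in X @ _ --> _](_ : _ = fun t => f (t *: sg y)).
    by rewrite reflectionZ; exact: fc.
  by apply/funext => u; rewrite reflectionZ.
have -> : (fun t => p * f (sg (t *: y)) + q * f (t *: y)) =
    (p \*: fun t => f (t *: sg y)) + (q \*: fun t => f (t *: y)).
  by apply/funext => u; rewrite reflectionZ.
apply: is_derive_eq.
  by apply: is_deriveD; apply: is_deriveZ; exact: fd.
rewrite radial_rhs_reflection// /radial_rhs /GRing.scale/=.
have -> : dot (s + rho Pos k) y = dot (sg s + rho Pos k) y + dot (s - sg s) y.
  by rewrite -dotDl [in RHS]addrC addrA subrK.
set S1 := \sum_(b <- Pos) _; set S2 := \sum_(b <- Pos) _; set S := \sum_(b <- Pos) _.
have -> : S = p * S1 + q * S2.
  rewrite /S1 /S2 !mulr_sumr -big_split/=; apply: eq_bigr => b _.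
  by rewrite !reflectionZ; ring.
rewrite reflectionZ.
have -> : q * ((dot (sg s + rho Pos k) y + dot (s - sg s) y) * f (t *: y) + S2) =
  q * (dot (sg s + rho Pos k) y * f (t *: y)) + q * S2 +
  (q * dot (s - sg s) y) * f (t *: y) by ring.
rewrite hpq; ring.
Qed.

End Hecke.

(** * Weyl invariance in the spectral parameter *)

Context (g : V -> V -> R).
Hypothesis hg : forall s, radial_solution Pos k s (g s).
Hypothesis hg0 : forall s, g s 0 = 1.

Definition weyl_sum s x : R := \sum_(w <- weyl_seq Phi) g s (w x).

Lemma weyl_sum_simple_pos a s x : simple_root a -> 0 < dot a s ->
  weyl_sum (reflection a s) x = weyl_sum s x.
Proof.
move=> ha as0; have aP := ha.1; have Wa := weyl_reflection (sPos aP).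
have aa : 0 < dot a a by rewrite dot_gt0// pos_neq0.
pose D := 2 * dot a s / dot a a; pose K := hecke_coef a.
have D0 : 0 < D by rewrite divr_gt0// mulr_gt0.
have KD : K + D != 0 by rewrite gt_eqF// ltr_wpDl// hecke_coef_ge0.
(* Since [s - reflection a s = D *: a], the condition reads [q * D = p * K]; the weights are
   normalized to sum to 1. Positivity of [dot a s] keeps [K + D] nonzero. *)
have sol : radial_solution Pos k (reflection a s)
    (fun y => D / (K + D) * g s (reflection a y) + K / (K + D) * g s y).
  apply: radial_solution_hecke => // y.
  have -> : s - reflection a s = D *: a by rewrite /reflection subKr.
  by rewrite dotZl -/K; ring.
rewrite /weyl_sum (radial_solution_unique hPhi hk0 sPos sol (hg _)); last first.
  rewrite !hg0 -(scale0r (0 : V)) reflectionZ !scale0r !hg0.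
  by field.
rewrite big_split/= -!mulr_sumr (sum_weyl_comp hPhi (fun w => g s (w x)) Wa).
by rewrite -mulrDl -mulrDl addrC divff// mul1r.
Qed.

Lemma weyl_sum_simple a s x : simple_root a ->
  weyl_sum (reflection a s) x = weyl_sum s x.
Proof.
move=> ha; have a0 := pos_neq0 ha.1.
have [as0|as0|as0] := ltgtP (dot a s) 0.
- rewrite -{2}(reflectionK a0 s) [RHS]weyl_sum_simple_pos//.
  by rewrite -dot_reflection_sym reflection_self// dotNl oppr_gt0.
- exact: weyl_sum_simple_pos.
- by rewrite /reflection as0 mulr0 mul0r scale0r subr0.
Qed.

(** Such a [u] permutes [Pos] and preserves [rho], hence carries the system for [u s] to the one for
    [s]. *)
Lemma weyl_sum_stable u s x : W u -> {in Pos, forall b, u b \in Pos} ->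
  weyl_sum (u s) x = weyl_sum s x.
Proof.
move=> Wu uP; have iu := weyl_inj hPhi Wu.
have sumE (H : V -> R) : \sum_(b <- Pos) H (u b) = \sum_(b <- Pos) H b.
  by apply: reindex_stable => //; exact: fset_uniq.
have rhoE y : dot (rho Pos k) (u y) = dot (rho Pos k) y.
  rewrite !dot_rho -sumE; congr (_ * _).
  rewrite big_seq [RHS]big_seq; apply: eq_bigr => b bP.
  by rewrite (hk Wu (sPos bP)) (weyl_dot hPhi Wu).
have u0 : u 0 = 0 by rewrite -[X in u X](scale0r (0 : V)) (weylZ Wu) scale0r.
have sol : radial_solution Pos k s (fun y => g (u s) (u y)).
  split => [y|y t t0].
    have -> : (fun t => g (u s) (u (t *: y))) = (fun t => g (u s) (t *: u y)).
      by apply/funext => t; rewrite (weylZ Wu).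
    exact: (hg _).1.
  have -> : (fun t => g (u s) (u (t *: y))) = (fun t => g (u s) (t *: u y)).
    by apply/funext => r; rewrite (weylZ Wu).
  apply: is_derive_eq; first exact: (hg _).2.
  rewrite /radial_rhs -sumE !dotDl (weyl_dot hPhi Wu) rhoE (weylZ Wu).
  congr (_ + _); rewrite big_seq [RHS]big_seq; apply: eq_bigr => b bP.
  rewrite (weyl_conj hPhi _ _ Wu) /rate (hk Wu (sPos bP)) (weyl_dot hPhi Wu).
  by rewrite !(weylZ Wu).
rewrite /weyl_sum -(sum_weyl_comp hPhi (fun w => g (u s) (w x)) Wu).
have E : g s = fun y => g (u s) (u y).
  apply: (radial_solution_unique hPhi hk0 sPos sol (hg _)).
  by rewrite u0 !hg0.
by apply: eq_bigr => w _; rewrite E.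
Qed.

(** Among the [u] with [weyl_sum \o u = weyl_sum \o w], one maximizing
    [dot (u v) v] maps [v] into the closed positive chamber, hence preserves
    [Pos]. *)
Lemma weyl_sum_invariant w s x : W w -> weyl_sum (w s) x = weyl_sum s x.
Proof.
move=> Ww.
have [|u [uW hu umax]] := @seq_argmin _ _ (weyl_seq Phi)
    (fun u => forall s, weyl_sum (u s) x = weyl_sum (w s) x)
    (fun u => - dot (u v) v).
  by exists w => //; rewrite mem_weyl_seq// inE.
have {uW}Wu : W u by move: uW; rewrite mem_weyl_seq// inE.
have dom b : b \in Pos -> 0 <= dot b (u v).
  move=> bP; rewrite leNgt; apply/negP => /(simple_root_exists bP)[a ha auv].
  have aP := ha.1; have := umax (reflection a \o u).
  rewrite mem_weyl_seq// inE => /(_ (weylM (sPos aP) Wu)).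
  have /[swap] /[apply] : forall s, weyl_sum ((reflection a \o u) s) x =
      weyl_sum (w s) x by move=> s'; rewrite /= weyl_sum_simple.
  (* Reflecting [u v] in [a] adds a positive multiple of [a], and [dot a v > 0], against
     maximality. *)
  rewrite lerN2 leNgt => /negP; apply.
  rewrite /= /reflection dotBl dotZl ltrDl oppr_gt0.
  rewrite pmulr_llt0; last by move: aP; rewrite mem_Pos => /andP[].
  by rewrite pmulr_llt0 ?invr_gt0 ?dot_gt0 ?pos_neq0// pmulr_rlt0.
rewrite -hu; apply: weyl_sum_stable => // b bP; apply/negPn/negP => ubN.
have := dom _ (pos_or_neg (weyl_root hPhi Wu (sPos bP)) ubN).
rewrite dotNl (weyl_dot hPhi Wu) oppr_ge0 leNgt => /negP; apply.
by move: bP; rewrite mem_Pos => /andP[].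
Qed.

End Symmetry.

(** * From the complex kernel to real radial solutions *)

Section Kernel.
Context {R : realType} {n : nat} (Pos : {fset 'rV[R]_n}).
Context (k : 'rV[R]_n -> R).
Notation V := 'rV[R]_n.
Implicit Types (x y s : V) (c : R) (z : R[i]).

Lemma dot_complexify s y : dot (complexify s) (complexify y) = (dot s y)%:C.
Proof. by rewrite /dot rmorph_sum; apply: eq_bigr => i _; rewrite !mxE -rmorphM. Qed.

Lemma is_derive_ray (h : V -> R) y (t : R) : (forall x, differentiable h x) ->
  is_derive t 1 (fun t => h (t *: y)) ('D_y h (t *: y)).
Proof.
move=> hd.
have dc : is_diff t (fun u : R => h (u *: y)) ('d h (t *: y) \o *:%R^~ y).
  exact: (is_diff_comp (is_diff_scalel t y) (differentiableP (hd _))).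
apply: DeriveDef; first by apply/derivable1_diffP; exact: ex_diff.
by rewrite deriveE ?diff_val//= ?scale1r ?deriveE.
Qed.

(** [pi] stands for the real or the imaginary part; for real [s] all coefficients are real, so each
    part solves the system separately. *)
Lemma radial_solution_part (pi : R[i] -> R) s (f : V -> R[i]) :
  (forall z z', pi (z + z') = pi z + pi z') ->
  (forall c z, pi (c%:C * z) = c * pi z) ->
  (forall v x, pi (cderive v f x) = 'D_v (fun y => pi (f y)) x) ->
  (forall x, differentiable (fun y => pi (f y)) x) ->
  (forall xi x, dunkl_cherednik Pos k xi f x =
     dot (complexify s) (complexify xi) * f x) ->
  radial_solution Pos k s (fun y => pi (f y)).
Proof.
move=> piD piZ pider pid heq; split => [y t|y t t0].
  have [dray _] := is_derive_ray y t pid.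
  exact/differentiable_continuous/derivable1_diffP.
apply: (is_derive_eq (is_derive_ray y t pid)).
have pi0 : pi 0 = 0 by rewrite -(mulr0 (0%:C)) piZ mul0r.
have piN z : pi (- z) = - pi z by apply: (addrI (pi z)); rewrite -piD !subrr pi0.
have := congr1 pi (heq y (t *: y)); rewrite dot_complexify /dunkl_cherednik.
rewrite !piD piN !piZ pider (big_morph pi piD pi0) => heq'.
rewrite /radial_rhs dotDl mulrDl -heq'.
set D := 'D_y _ _; set S := \sum_(b <- Pos) _; set S' := \sum_(b <- Pos) _.
suff -> : S' = - S by ring.
rewrite -sumrN; apply: eq_bigr => b _; rewrite piZ /difference_quotient dotZr /rate.
(* On the hyperplane the factor [dot b y] vanishes, whatever the value of the extended quotient. *)
have [->|b0] := eqVneq (dot b y) 0; first by rewrite !(mulr0, mul0r) oppr0.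
rewrite mulf_eq0 (gt_eqF t0) (negbTE b0)/=.
rewrite [_ / _%:C]mulrC -fmorphV piZ piD piN reflectionZ.
by ring.
Qed.

Lemma kernel_real s (f : V -> R[i]) :
  opdam_cherednik_kernel Pos k (complexify s) f ->
  radial_solution Pos k s (fun y => complex.Re (f y)) /\
  radial_solution Pos k s (fun y => complex.Im (f y)).
Proof.
move=> [hsm heq _]; have [[hRe _] [hIm _]] := hsm 1%N.
by split; apply: radial_solution_part => //;
  [move=> [a b] [a' b']|move=> c [a b] /=; ring
  |move=> [a b] [a' b']|move=> c [a b] /=; ring].
Qed.

End Kernel.

(** * Averaging over the group and convexity *)

Lemma hoelder_sum (R : realType) (T : Type) (s : seq T) (u v : T -> R) (th : R) :
  0 < th < 1 -> (forall i, 0 < u i) -> (forall i, 0 < v i) ->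
  \sum_(i <- s) u i `^ th * v i `^ (1 - th) <=
  (\sum_(i <- s) u i) `^ th * (\sum_(i <- s) v i) `^ (1 - th).
Proof.
move=> th01 u0 v0; case: s => [|i0 s].
  by rewrite big_nil mulr_ge0// powR_ge0.
set A := \sum_(i <- _) u i; set B := \sum_(i <- _) v i.
have A0 : 0 < A by rewrite /A big_cons ltr_pwDl// sumr_ge0// => i _; exact: ltW.
have B0 : 0 < B by rewrite /B big_cons ltr_pwDl// sumr_ge0// => i _; exact: ltW.
set C := A `^ th * B `^ (1 - th).
have C0 : 0 <= C by rewrite mulr_ge0// powR_ge0.
(* Normalized by [A] and [B], the weights sum to 1, and the mean inequality applies term by term. *)
have -> : C = \sum_(i <- i0 :: s) C * (th * (u i / A) + (1 - th) * (v i / B)).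
  rewrite -mulr_sumr big_split/= -!mulr_sumr -!mulr_suml !divff ?gt_eqF//.
  by ring.
apply: ler_sum => i _.
apply: le_trans (ler_wpM2l C0 (weighted_am_gm th01 _ _)); rewrite ?divr_gt0//.
rewrite /C mulrACA -!powRM ?divr_ge0 ?(ltW A0) ?(ltW B0) ?(ltW (u0 i)) ?(ltW (v0 i))//.
by rewrite ![_ * (_ / _)]mulrC !divfK ?gt_eqF//.
Qed.

(** The sublevel set of [F] at level [F x] is convex and contains the orbit of [x], hence its convex
    hull. *)
Lemma log_convex_weyl_convex (R : realType) (n : nat) (Phi : {fset 'rV[R]_n})
    (F : 'rV[R]_n -> R) : (forall s, 0 < F s) ->
  (forall w s, weyl_group Phi w -> F (w s) = F s) ->
  log_convex setT F -> weyl_convex Phi F.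
Proof.
move=> F0 Finv [_ Flc] x y hy.
apply: (hy [set z | F z <= F x]); split; last first.
  by move=> _ [w Ww <-] /=; rewrite Finv.
apply/convex_setW => a b; rewrite !inE /= => Fa Fb t t0 t1.
have t01 : 0 < t%:num < 1 by rewrite t0.
rewrite ?inE; change (F (t%:num *: a + (1 - t%:num) *: b) <= F x).
apply: le_trans (Flc a b t%:num I I t01) _.
apply: le_trans (weighted_am_gm t01 (F0 a) (F0 b)) _.
have -> : F x = t%:num * F x + (1 - t%:num) * F x by ring.
by rewrite lerD// ler_wpM2l// ?subr_ge0 ltW.
Qed.

Theorem corollary4p7 (R : realType) (n : nat) (Phi Pos : {fset 'rV[R]_n})
    (k : 'rV[R]_n -> R) (G : 'rV[R[i]]_n -> 'rV[R]_n -> R[i])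
    (hPhi : root_system Phi) (hirr : irreducible_roots Phi)
    (hPos : positive_roots Phi Pos)
    (hk : multiplicity Phi k) (hk0 : forall a, a \in Phi -> 0 <= k a)
    (hG : forall s, opdam_cherednik_kernel Pos k s (G s)) (x : 'rV[R]_n) :
  exists F : 'rV[R]_n -> R,
    [/\ forall s, heckman_opdam Phi (G (complexify s)) x = (F s)%:C,
        log_convex setT F & weyl_convex Phi F].
Proof.
have [v [hv PosE]] := hPos.
have memP a : (a \in Pos) = (a \in Phi) && (0 < dot a v).
  by rewrite PosE !inE.
have sPos := pos_root memP.
pose g s y := complex.Re (G (complexify s) y).
have hg s : radial_solution Pos k s (g s) := (kernel_real (hG (complexify s))).1.
have g1 s : g s 0 = 1 by rewrite /g; have [_ _ ->] := hG (complexify s).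
have g0 s y : 0 < g s y by apply: (radial_solution_gt0 hPhi hk0 sPos (hg s)).
have GE s y : G (complexify s) y = (g s y)%:C.
  (* The imaginary part solves the same system with initial value 0, so uniqueness makes it
     vanish. *)
  have hI := (kernel_real (hG (complexify s))).2.
  have h0 : radial_solution Pos k s (fun=> 0).
    split=> [z|z t _]; first exact: cst_continuous.
    apply: (is_derive_eq (is_derive_cst _ _ _)).
    by rewrite /radial_rhs big1 => [|b _]; rewrite ?subrr !mulr0 ?addr0.
  have I0 : complex.Im (G (complexify s) 0) = 0 by have [_ _ ->] := hG (complexify s).
  have := congr1 (fun h => h y) (radial_solution_unique hPhi hk0 sPos h0 hI I0).
  by rewrite /g; case: (G _ _) => a b /= ->.
pose N : R := #|` fset_set (weyl_group Phi)|%:R.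
have N0 : 0 < N.
  rewrite ltr0n cardfs_gt0; apply/fset0Pn; exists id.
  by rewrite in_fset_set ?inE; [exact: weyl1|exact: finite_weyl].
pose F s := \sum_(w <- weyl_seq Phi) N^-1 * g s (w x).
have FE s : F s = N^-1 * weyl_sum Phi g s x by rewrite /F -mulr_sumr.
have idW : id \in weyl_seq Phi by rewrite mem_weyl_seq// inE; exact: weyl1.
have F0 s : 0 < F s.
  rewrite /F (big_rem _ idW)/= ltr_pwDl//; first by rewrite mulr_gt0 ?invr_gt0.
  by apply: sumr_ge0 => w _; rewrite ltW// mulr_gt0 ?invr_gt0.
have Flc : log_convex setT F.
  split=> [s _|s1 s2 th _ _ th01]; first exact: ltW.
  apply: le_trans (hoelder_sum _ th01 _ _) => [|w|w]; last 2 first.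
  - by rewrite mulr_gt0 ?invr_gt0.
  - by rewrite mulr_gt0 ?invr_gt0.
  (* The exponents [th] and [1 - th] recombine the two powers of [N^-1] into [N^-1]. *)
  apply: ler_sum => w _; rewrite !powRM ?invr_ge0 ?(ltW N0) ?(ltW (g0 _ _))//.
  rewrite mulrACA -powRD; last by rewrite invr_eq0 (gt_eqF N0) implybT.
  rewrite subrKC powRr1 ?invr_ge0 ?(ltW N0)// ler_wpM2l ?invr_ge0 ?(ltW N0)//.
  exact: (radial_solution_log_convex hPhi hk0 sPos th01 (hg s1) (hg s2) (hg _)).
exists F; split => //.
- move=> s; rewrite /heckman_opdam fsbig_finite; last exact: finite_weyl.
  rewrite FE rmorphM fmorphV rmorph_nat rmorph_sum; congr (_ * _).
  by apply: eq_bigr => w _; rewrite GE.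
- apply: log_convex_weyl_convex => // w s Ww; rewrite !FE; congr (_ * _).
  exact: (weyl_sum_invariant hPhi hk hk0 hv memP).
Qed.
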